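(* There is an absolute constant $C>0$ such that for all distinct points $x,y\in\mathbb{R}^2$, $$|H_1(x,y)|\le C\min\left\{\langle y\rangle\Big(1+\frac1{|x-y|}\Big),\ \langle x\rangle\Big(1+\frac1{|x-y|}\Big)\right\}$$ and $$|H_2(x,y)|\le C\min\left\{\langle x\rangle^2\Big(1+\frac1{|x-y|}\Big),\ \langle y\rangle^2\Big(1+\frac1{|x-y|}\Big),\ \langle x\rangle\langle y\rangle\Big(1+\frac1{|x-y|}\Big)\right\}.$$
   Context: $\langle x\rangle=(1+|x|^2)^{1/2}$; $\wedge$ is the cross product on $\mathbb{R}^3$; $\xi(x_1,x_2,x_3)=(x_2,-x_1,1)$; for $a\in\mathbb{R}$, $y\in\mathbb{R}^2$, $R_a y=(y_1\cos a+y_2\sin a,\,-y_1\sin a+y_2\cos a)$. For distinct $x,y\in\mathbb{R}^2$, $$K(x,y)=-\frac1{4\pi}\int_{\mathbb{R}}\frac{(x_1,x_2,0)-(R_a y,a)}{|(x_1,x_2,0)-(R_a y,a)|^3}\wedge\xi(R_a y,a)\,da\in\mathbb{R}^3,$$ $H_1(x,y)=(K^1(x,y),K^2(x,y))$ and $H_2(x,y)=(-x_2,x_1)K^3(x,y)$. *)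

(* Defs.v *)
From HB Require Import structures.
From mathcomp Require Import all_boot all_order all_algebra.
From mathcomp Require Import all_classical all_reals all_analysis.

Set Implicit Arguments.
Unset Strict Implicit.
Unset Printing Implicit Defensive.
Import Order.TTheory GRing.Theory Num.Theory.
Import numFieldNormedType.Exports.
Local Open Scope ring_scope.

(* Euclidean norm; the library's `|v| on matrices is the sup norm. *)
Definition enorm (R : realType) (n : nat) (v : 'rV[R]_n) : R :=
  Num.sqrt (\sum_(i < n) v ord0 i ^+ 2).

Definition jbracket (R : realType) (n : nat) (v : 'rV[R]_n) : R :=
  Num.sqrt (1 + enorm v ^+ 2).

Definition vec2 (R : realType) (a b : R) : 'rV[R]_2 :=
  \row_(i < 2) [:: a; b]`_i.

Definition vec3 (R : realType) (a b c : R) : 'rV[R]_3 :=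
  \row_(i < 3) [:: a; b; c]`_i.

(* Coordinates are indexed from 0: x 0 0 is x_1, x 0 1 is x_2, x 0 2 is x_3. *)
Definition crossp (R : realType) (u v : 'rV[R]_3) : 'rV[R]_3 :=
  vec3 (u 0 1 * v 0 2 - u 0 2 * v 0 1)
       (u 0 2 * v 0 0 - u 0 0 * v 0 2)
       (u 0 0 * v 0 1 - u 0 1 * v 0 0).

Definition xi (R : realType) (p : 'rV[R]_3) : 'rV[R]_3 :=
  vec3 (p 0 1) (- p 0 0) 1.

Definition rot (R : realType) (a : R) (y : 'rV[R]_2) : 'rV[R]_2 :=
  vec2 (y 0 0 * cos a + y 0 1 * sin a) (- y 0 0 * sin a + y 0 1 * cos a).

Definition lift3 (R : realType) (x : 'rV[R]_2) (t : R) : 'rV[R]_3 :=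
  vec3 (x 0 0) (x 0 1) t.

Definition kernel_integrand (R : realType) (x y : 'rV[R]_2) (a : R) :
    'rV[R]_3 :=
  let p := lift3 (rot a y) a in
  let d := lift3 x 0 - p in
  crossp ((enorm d ^+ 3)^-1 *: d) (xi p).

(* The vector-valued integral is taken componentwise. For x != y the integrand
   is continuous in a and O(a^-2) at infinity, so each component is Lebesgue
   integrable and Rintegral returns the genuine value. *)
Definition kernelK (R : realType) (x y : 'rV[R]_2) : 'rV[R]_3 :=
  - (4 * pi)^-1 *:
    \row_(i < 3) \int[@lebesgue_measure R]_a (kernel_integrand x y a) ord0 i.

Definition H1 (R : realType) (x y : 'rV[R]_2) : 'rV[R]_2 :=
  vec2 (kernelK x y 0 0) (kernelK x y 0 1).

Definition H2 (R : realType) (x y : 'rV[R]_2) : 'rV[R]_2 :=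
  kernelK x y 0 2 *: vec2 (- x 0 1) (x 0 0).

(* Main.v *)
(** Write N(a) = |x - R_a y|^2 + a^2 for the squared distance in the kernel and
J for the integral of 1/N. Pointwise, the first two components of the integrand
are at most (1 + |y|)/N and the third is at most |y|/N. Writing x, y in polar
coordinates with angle t between them,
N(a) = (|x| - |y|)^2 + 2|x||y|(1 - cos (a - t)) + a^2, and completing the square
near a = 0 bounds 1/N by a Lorentzian of integral O(1/|x-y|); elsewhere
1/N <= 1/a^2. Hence J = O(1 + 1/|x-y|). If one of |x|, |y| is more than twice the
other plus one, then N(a) >= a^2 + max(|x|,|y|)^2/4, so J = O(1/max(|x|,|y|)),
which makes the smaller of the two norms the relevant one in each bound. *)
Require Import Defs.
From HB Require Import structures.
From mathcomp Require Import all_boot all_order all_algebra.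
From mathcomp Require Import all_classical all_reals all_analysis.
From mathcomp Require Import measurable_realfun ring lra.
Set Implicit Arguments.
Unset Strict Implicit.
Unset Printing Implicit Defensive.
Import Order.TTheory GRing.Theory Num.Theory.
Import numFieldNormedType.Exports.
Local Open Scope ring_scope.

(** * Lorentzian weights and their integrals over the line *)

(** The derivative of [atan (k * (a - b))]: for [k > 0] its integral over the line is pi, however
    narrow the peak. *)
Definition lorentzian {R : realType} (k b a : R) : R := k / oneDsqr (k * (a - b)).

Lemma lorentzian_ge0 (R : realType) (k b a : R) : 0 < k -> 0 <= lorentzian k b a.
Proof. by move=> k0; rewrite divr_ge0 ?ltW// (lt_le_trans ltr01)// oneDsqr_ge1. Qed.

Lemma continuous_lorentzian (R : realType) (k b : R) : continuous (lorentzian k b).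
Proof.
move=> a; apply: cvgM; first exact: cvg_cst.
apply: (@continuous_comp _ _ _ (fun a => k * (a - b)) (fun x => (oneDsqr x)^-1)).
  by apply: cvgM; [exact: cvg_cst|apply: cvgB => //; exact: cvg_cst].
exact: continuous_oneDsqrV.
Qed.

(** The substitution u = k (a - b) absorbs the factor [k]; the integrand 1/(1 + u^2) is even, so its
    integral is twice the half-line value pi/2. *)
Lemma integral_lorentzian (R : realType) (k b : R) : 0 < k ->
  (\int[lebesgue_measure]_a (lorentzian k b a)%:E = (pi : R)%:E)%E.
Proof.
move=> k0; pose F (a : R) := k * (a - b).
have dF (a : R) : is_derive a 1 F k.
  apply: is_derive_eq; rewrite /GRing.scale/=; lra.
have F'E : derive1 F = cst k by apply/funext => a; rewrite derive1E derive_val.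
transitivity (\int[lebesgue_measure]_x
    ((((fun x => (oneDsqr x)^-1) \o F) * derive1 F) x)%:E)%E.
  by apply: eq_integral => a _; rewrite F'E/= /lorentzian mulrC.
rewrite -(@increasing_ge0_integration_by_substitutionT R F (fun x => (oneDsqr x)^-1)).
- rewrite ge0_symfun_integralT//.
  + rewrite -set_itvcy integral0y_oneDsqr -EFinM; congr EFin; lra.
  + exact: continuous_oneDsqrV.
  + by move=> x; rewrite /= /oneDsqr sqrrN.
- by move=> x y xy; rewrite /F ltr_pM2l// ltrD2r.
- by rewrite F'E; move=> x; exact: cvg_cst.
- by rewrite F'E; exact: is_cvg_cst.
- by rewrite F'E; exact: is_cvg_cst.
- by move=> x; apply: ex_derive.
- by apply/gt0_cvgMrNy => //; exact: cvg_addrr_Ny.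
- by apply/gt0_cvgMry => //; exact: cvg_addrr.
- exact: continuous_oneDsqrV.
- by move=> x; rewrite invr_ge0 (le_trans ler01)// oneDsqr_ge1.
Qed.

Lemma integrable_lorentzian (R : realType) (k b : R) : 0 < k ->
  lebesgue_measure.-integrable [set: R] (EFin \o lorentzian k b).
Proof.
move=> k0; apply/integrableP; split.
  apply/measurable_EFinP; apply: continuous_measurable_fun.
  exact: continuous_lorentzian.
under eq_integral do rewrite /= ger0_norm ?lorentzian_ge0//.
by rewrite integral_lorentzian// ltry.
Qed.

Lemma Rintegral_lorentzian (R : realType) (k b : R) : 0 < k ->
  \int[lebesgue_measure]_a lorentzian k b a = pi :> R.
Proof. by move=> k0; rewrite /Rintegral integral_lorentzian. Qed.

(** * Quadratic bounds for the cosine, and polar angles *)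

Lemma sin_sqr_le (R : realType) (x : R) : sin x ^+ 2 <= x ^+ 2.
Proof.
wlog x0 : x / 0 <= x => [hw|].
  case: (leP 0 x) => [/hw//|/ltW x0].
  by have := hw (- x); rewrite sinN !sqrrN oppr_ge0; apply.
have [|c _] := @MVT_segment R sin cos 0 x x0 (fun y _ => is_derive_sin y).
  exact/continuous_subspaceT/continuous_sin.
rewrite sin0 !subr0 => ->.
by rewrite exprMn ler_piMl ?sqr_ge0// cos2sin2 gerBl sqr_ge0.
Qed.

Lemma one_sub_cosE (R : realType) (x : R) : 1 - cos x = 2 * sin (x / 2) ^+ 2.
Proof.
rewrite {1}(splitr x) cosD -!expr2 cos2sin2; ring.
Qed.

Lemma one_sub_cos_le (R : realType) (x : R) : 1 - cos x <= x ^+ 2 / 2.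
Proof. by rewrite one_sub_cosE; have := sin_sqr_le (x / 2); lra. Qed.

(** By the mean value theorem sin (x/2) = (x/2) cos c with c between 0 and 9/8, where cos c >= 1 -
    c^2/2 >= 1/3; hence 2 sin^2 (x/2) >= x^2/18. The range 9/4 = 2 + 1/4 is that of a - t for |t| <=
    2 and |a| <= 1/4. *)
Lemma one_sub_cos_ge (R : realType) (x : R) : `|x| <= 9 / 4 ->
  x ^+ 2 / 18 <= 1 - cos x.
Proof.
wlog x0 : x / 0 <= x => [hw|].
  case: (leP 0 x) => [/hw//|/ltW x0].
  by rewrite -normrN -sqrrN -cosN; apply: hw; rewrite oppr_ge0.
rewrite ger0_norm// => x94; rewrite one_sub_cosE.
have x20 : 0 <= x / 2 by lra.
have [|c] := @MVT_segment R sin cos 0 (x / 2) x20 (fun y _ => is_derive_sin y).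
  exact/continuous_subspaceT/continuous_sin.
rewrite sin0 !subr0 in_itv/= => /andP[c0 cx] ->.
have := one_sub_cos_le c => hc.
have c1 : 1 / 3 <= cos c by nra.
rewrite exprMn.
have : (1 / 3) ^+ 2 <= cos c ^+ 2 by rewrite ler_pXn2r// nnegrE; lra.
have := sqr_ge0 (x / 2); nra.
Qed.

(** As P >= 0, the arcsine of Q over the radius is a correct polar angle. It lies in [-pi/2, pi/2],
    and 2 is a rational bound for pi/2. *)
Lemma polar_right (R : realType) (P Q : R) : 0 <= P ->
  exists t : R, [/\ `|t| <= 2, P = Num.sqrt (P ^+ 2 + Q ^+ 2) * cos t
                  & Q = Num.sqrt (P ^+ 2 + Q ^+ 2) * sin t].
Proof.
move=> P0; set m := Num.sqrt _.
have m2 : m ^+ 2 = P ^+ 2 + Q ^+ 2 by rewrite sqr_sqrtr// addr_ge0// sqr_ge0.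
have m_ge0 : 0 <= m by exact: sqrtr_ge0.
have [m0|m_neq0] := eqVneq m 0.
  exists 0; move: m2; rewrite m0 => m2; split; first by rewrite normr0.
  - by rewrite mul0r; nra.
  - by rewrite mul0r; nra.
have m_gt0 : 0 < m by rewrite lt_neqAle eq_sym m_neq0.
have Qm : -1 <= Q / m <= 1.
  by rewrite ler_pdivlMr// ler_pdivrMr//; apply/andP; split; nra.
have QmE : sin (asin (Q / m)) = Q / m by rewrite asinK// in_itv.
exists (asin (Q / m)); split.
- have := pihalf_lt2 R; have := asin_geNpi2 Qm; have := asin_lepi2 Qm => *.
  by rewrite ler_norml; lra.
- rewrite cos_asin// (_ : 1 - _ = (P / m) ^+ 2).
    by rewrite sqrtr_sqr ger0_norm ?divr_ge0// mulrC divfK.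
  by rewrite !exprMn -[1](@divff _ (m ^+ 2)) ?expf_neq0// {1}m2 -exprVn; ring.
- by rewrite QmE mulrC divfK.
Qed.

(* The right-hand side is [p / ((p * (a - b)) ^+ 2 + s ^+ 2)]. *)
Lemma inv_le_lorentzian (R : realType) (p s b a N : R) : 0 < p -> 0 < s ->
  (p * (a - b)) ^+ 2 + s ^+ 2 <= p * N -> N^-1 <= s^-1 * lorentzian (p / s) b a.
Proof.
move=> p0 s0 h.
have d0 : 0 < (p * (a - b)) ^+ 2 + s ^+ 2 by rewrite ltr_wpDl ?sqr_ge0 ?exprn_gt0.
have N0 : 0 < N by rewrite -(pmulr_rgt0 _ p0) (lt_le_trans d0).
have -> : s^-1 * lorentzian (p / s) b a = p / ((p * (a - b)) ^+ 2 + s ^+ 2).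
  rewrite /lorentzian /oneDsqr; field; by rewrite !gt_eqF.
by rewrite ler_pdivlMr// mulrC ler_pdivrMr.
Qed.

Lemma normr_le_sqr (R : realType) (u v : R) : 0 <= v -> u ^+ 2 <= v ^+ 2 ->
  `|u| <= v.
Proof.
by move=> v0 uv; rewrite -(@ler_pXn2r _ 2) ?nnegrE// real_normK ?num_real.
Qed.

Section Kernel.
Variable R : realType.
Implicit Types x y : 'rV[R]_2.

Local Notation mu := (@lebesgue_measure R).

(** * Euclidean norms and brackets *)

Lemma enorm_ge0 n (v : 'rV[R]_n) : 0 <= enorm v.
Proof. exact: sqrtr_ge0. Qed.

Lemma enorm_sqr n (v : 'rV[R]_n) : enorm v ^+ 2 = \sum_(i < n) v ord0 i ^+ 2.
Proof. by rewrite sqr_sqrtr// sumr_ge0// => i _; exact: sqr_ge0. Qed.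

Lemma enorm2_sqr x : enorm x ^+ 2 = x 0 0 ^+ 2 + x 0 1 ^+ 2.
Proof.
rewrite enorm_sqr !big_ord_recl big_ord0 addr0.
by congr (_ + x _ _ ^+ 2); exact/val_inj.
Qed.

Lemma enorm_eq0 n (v : 'rV[R]_n) : enorm v = 0 -> v = 0.
Proof.
move=> v0; have /esym/eqP := enorm_sqr v; rewrite v0 expr0n/= psumr_eq0; last first.
  by move=> i _; exact: sqr_ge0.
move=> /allP h; apply/rowP => i; rewrite mxE; apply/eqP.
by have := h i (mem_index_enum _); rewrite sqrf_eq0 => /implyP; apply.
Qed.

Lemma enormB_gt0 n (v w : 'rV[R]_n) : v != w -> 0 < enorm (v - w).
Proof.
move=> vw; rewrite lt_neqAle enorm_ge0 andbT eq_sym.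
by apply: contra vw => /eqP/enorm_eq0/eqP; rewrite subr_eq0.
Qed.

Lemma jbracket_ge n (v : 'rV[R]_n) : 1 <= jbracket v /\ enorm v <= jbracket v.
Proof.
split.
  by rewrite -[leLHS]sqrtr1 ler_wsqrtr// lerDl sqr_ge0.
by rewrite -[leLHS]ger0_norm ?enorm_ge0// -sqrtr_sqr ler_wsqrtr// lerDr.
Qed.

(** * Lower bounds for the squared distance *)

(** Its squared norm is the N(a) of the overview. *)
Definition chord x y (a : R) : 'rV[R]_3 := lift3 x 0 - lift3 (Defs.rot a y) a.

Lemma chord_sqr x y a : enorm (chord x y a) ^+ 2 =
  (x 0 0 - Defs.rot a y 0 0) ^+ 2 + (x 0 1 - Defs.rot a y 0 1) ^+ 2 + a ^+ 2.
Proof.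
rewrite enorm_sqr !big_ord_recl big_ord0 addr0 !mxE/= addrA.
by rewrite sub0r sqrrN.
Qed.

Lemma chord_sqrE x y a : enorm (chord x y a) ^+ 2 =
  enorm x ^+ 2 + enorm y ^+ 2
  - 2 * ((x 0 0 * y 0 0 + x 0 1 * y 0 1) * cos a
         + (x 0 0 * y 0 1 - x 0 1 * y 0 0) * sin a) + a ^+ 2.
Proof.
rewrite chord_sqr !enorm2_sqr !mxE/=.
have := cos2Dsin2 a; move: (cos a) (sin a) => c s cs.
have /= := congr1 (fun z => (y 0 0 ^+ 2 + y 0 1 ^+ 2) * z) cs; lra.
Qed.

(** Lagrange's identity. The dot product P and the determinant Q are |x||y| times the cosine and
    sine of the angle from x to y; they are the coefficients of [cos a] and [sin a] in
    [chord_sqrE]. *)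
Lemma dot_sqr_add_det_sqr x y :
  (x 0 0 * y 0 0 + x 0 1 * y 0 1) ^+ 2 + (x 0 0 * y 0 1 - x 0 1 * y 0 0) ^+ 2
  = (enorm x * enorm y) ^+ 2.
Proof. by rewrite exprMn !enorm2_sqr; ring. Qed.

(** Cauchy-Schwarz bounds P cos a + Q sin a by |x||y|, the defect between the squares being (P sin a
    - Q cos a)^2. *)
Lemma chord_sqr_ge x y a :
  (enorm x - enorm y) ^+ 2 + a ^+ 2 <= enorm (chord x y a) ^+ 2.
Proof.
rewrite chord_sqrE.
have := dot_sqr_add_det_sqr x y.
set P := (_ + _ * y 0 1); set Q := (_ - _ * y 0 0) => PQ.
have m0 : 0 <= enorm x * enorm y by rewrite mulr_ge0 ?enorm_ge0.
have : P * cos a + Q * sin a <= enorm x * enorm y.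
  apply: le_trans (ler_norm _) _.
  apply: normr_le_sqr => //; rewrite -PQ.
  have /= := congr1 (fun z => (P ^+ 2 + Q ^+ 2) * z) (cos2Dsin2 a).
  have := sqr_ge0 (P * sin a - Q * cos a); lra.
lra.
Qed.

(** This is the hypothesis of [inv_le_lorentzian] with s = |x - y|/3. The resulting Lorentzian bound
    has integral pi/s whatever p is, so p may grow with |x||y|. *)
Lemma chord_near x y : exists p b : R, 1 <= p /\ forall a, `|a| <= 1 / 4 ->
  (p * (a - b)) ^+ 2 + (enorm (x - y) / 3) ^+ 2 <= p * enorm (chord x y a) ^+ 2.
Proof.
have rE : enorm (x - y) ^+ 2 = enorm x ^+ 2 + enorm y ^+ 2
    - 2 * (x 0 0 * y 0 0 + x 0 1 * y 0 1).
  by rewrite !enorm2_sqr !mxE; ring.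
have := dot_sqr_add_det_sqr x y; move: rE (chord_sqrE x y).
set P := (_ + _ * y 0 1); set Q := (_ - _ * y 0 0) => rE NE PQ.
have X0 : 0 <= enorm x by exact: enorm_ge0.
have Y0 : 0 <= enorm y by exact: enorm_ge0.
set m := enorm x * enorm y in PQ.
have m0 : 0 <= m by rewrite mulr_ge0.
have XYm : 0 <= enorm x ^+ 2 + enorm y ^+ 2 - 2 * m.
  have := sqr_ge0 (enorm x - enorm y); rewrite /m; nra.
rewrite exprMn rE.
have [P0|P0] := leP 0 P; last first.
  (* At an obtuse angle, a rotation by at most 1/4 cannot bring y close to x. *)
  exists 1, 0; split=> // a a4; rewrite subr0 !mul1r NE.
  have c0 : 0 <= cos a by have := one_sub_cos_le a; move: a4; rewrite ler_norml; nra.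
  have s4 : `|sin a| <= 1 / 4.
    apply: le_trans a4; apply: normr_le_sqr => //.
    by rewrite real_normK ?num_real ?sin_sqr_le.
  have Qm : `|Q| <= m by apply: normr_le_sqr; rewrite -?PQ ?lerDr ?sqr_ge0.
  have Pm : `|P| <= m by apply: normr_le_sqr; rewrite -?PQ ?lerDl ?sqr_ge0.
  have : Q * sin a <= m * (1 / 4).
    by apply: le_trans (ler_norm _) _; rewrite normrM ler_pM.
  move: Pm; rewrite ler_norml => /andP[Pm _].
  have : P * cos a <= 0 by nra.
  nra.
have [t] := polar_right Q P0.
rewrite PQ sqrtr_sqr (ger0_norm m0) => -[t2 Pt Qt].
have q0 : 0 <= m / 9 by rewrite divr_ge0.
(* With q = m/9, [one_sub_cos_ge] will give N(a) >= (|x| - |y|)^2 + q (a - t)^2 + a^2. The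
   coefficient of a^2 on the right is p = 1 + q, and the minimum is at b = q t / p. *)
exists (1 + m / 9), (m / 9 * t / (1 + m / 9)); split; first by rewrite lerDl.
move=> a a4.
have p0 : 1 + m / 9 != 0 by rewrite gt_eqF// ltr_pwDl.
have u94 : `|a - t| <= 9 / 4 by move: a4 t2; rewrite !ler_norml; lra.
have := one_sub_cos_ge u94; rewrite cosB => hu.
have ht := one_sub_cos_le t.
have -> : ((1 + m / 9) * (a - m / 9 * t / (1 + m / 9))) ^+ 2
  = ((1 + m / 9) * a - m / 9 * t) ^+ 2.
  by rewrite mulrBr [X in _ - X]mulrC divfK.
rewrite NE Pt Qt.
set E := enorm x ^+ 2 + enorm y ^+ 2 in XYm *.
set q := m / 9 in q0 *; have mq : m = 9 * q by rewrite /q; field.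
have h1 : E - 2 * m + q * (a - t) ^+ 2 + a ^+ 2 <=
   E - 2 * (m * cos t * cos a + m * sin t * sin a) + a ^+ 2.
  by rewrite mq; move: (cos a) (cos t) (sin a) (sin t) hu => *; nra.
(* The left side is |x - y|^2. The coefficient 9 is why |x - y| is divided by 3. *)
have h2 : E - 2 * (m * cos t) <= E - 2 * m + 9 * q * t ^+ 2.
  by rewrite mq; move: (cos t) ht => *; nra.
(* Completing the square leaves the remainder q t^2, which absorbs a ninth of the last term of
   [h2]. *)
have h3 : (1 + q) * (E - 2 * m + q * (a - t) ^+ 2 + a ^+ 2) =
   (1 + q) * (E - 2 * m) + ((1 + q) * a - q * t) ^+ 2 + q * t ^+ 2 by ring.
have h4 : (1 + q) * (E - 2 * m + q * (a - t) ^+ 2 + a ^+ 2) <= (1 + q) *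
   (E - 2 * (m * cos t * cos a + m * sin t * sin a) + a ^+ 2).
  by rewrite ler_pM2l// ltr_pwDl.
apply: le_trans h4; rewrite h3.
have : 0 <= q * (E - 2 * m) by rewrite mulr_ge0.
have : 0 <= q * t ^+ 2 by rewrite mulr_ge0 ?sqr_ge0.
move: h2; lra.
Qed.

(** * Pointwise bounds for the integrand *)

Lemma normr_coord_le n (v : 'rV[R]_n) i : `|v 0 i| <= enorm v.
Proof.
apply: normr_le_sqr; first exact: enorm_ge0.
by rewrite enorm_sqr (bigD1 i)//= lerDl sumr_ge0// => j _; exact: sqr_ge0.
Qed.

Lemma enorm_rot a y : enorm (Defs.rot a y) = enorm y.
Proof.
apply/eqP; rewrite -(@eqrXn2 _ 2) ?enorm_ge0//; apply/eqP.
rewrite !enorm2_sqr !mxE/=.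
have /= := congr1 (fun z => (y 0 0 ^+ 2 + y 0 1 ^+ 2) * z) (cos2Dsin2 a); lra.
Qed.

Lemma chord_coord x y a :
  [/\ chord x y a 0 0 = x 0 0 - Defs.rot a y 0 0,
      chord x y a 0 1 = x 0 1 - Defs.rot a y 0 1 & chord x y a 0 2 = - a].
Proof. by split; rewrite !mxE//= sub0r. Qed.

Lemma xi_coord (w : 'rV[R]_2) a :
  [/\ xi (lift3 w a) 0 0 = w 0 1, xi (lift3 w a) 0 1 = - w 0 0
    & xi (lift3 w a) 0 2 = 1].
Proof. by split; rewrite !mxE//= !mxE. Qed.

Lemma kernel_integrand0E x y a (z := Defs.rot a y) :
  kernel_integrand x y a 0 0 =
  (enorm (chord x y a) ^+ 3)^-1 * (x 0 1 - z 0 1 - a * z 0 0).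
Proof.
rewrite /kernel_integrand -/(chord x y a).
have [d0 d1 d2] := chord_coord x y a; have [e0 e1 e2] := xi_coord z a.
rewrite /crossp [LHS]mxE/= !(mxE, e0, e1, e2, d0, d1, d2)/= -/z; ring.
Qed.

Lemma kernel_integrand1E x y a (z := Defs.rot a y) :
  kernel_integrand x y a 0 1 =
  (enorm (chord x y a) ^+ 3)^-1 * (- a * z 0 1 - (x 0 0 - z 0 0)).
Proof.
rewrite /kernel_integrand -/(chord x y a).
have [d0 d1 d2] := chord_coord x y a; have [e0 e1 e2] := xi_coord z a.
rewrite /crossp [LHS]mxE/= !(mxE, e0, e1, e2, d0, d1, d2)/= -/z; ring.
Qed.

Lemma kernel_integrand2E x y a (z := Defs.rot a y) :
  kernel_integrand x y a 0 2 =
  (enorm (chord x y a) ^+ 3)^-1 * (- ((x 0 0 - z 0 0) * z 0 0 + (x 0 1 - z 0 1) * z 0 1)).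
Proof.
rewrite /kernel_integrand -/(chord x y a).
have [d0 d1 d2] := chord_coord x y a; have [e0 e1 e2] := xi_coord z a.
rewrite /crossp [LHS]mxE/= !(mxE, e0, e1, e2, d0, d1, d2)/= -/z; ring.
Qed.

(** The last chord coordinate is -a, so each term of the numerators contains a chord coordinate,
    which gains one power against D^3. The constant entry of [xi] produces the 1 and enters only the
    first two components. *)
Lemma kernel_integrand_le x y a :
  [/\ `|kernel_integrand x y a 0 0| <= (1 + enorm y) / enorm (chord x y a) ^+ 2,
      `|kernel_integrand x y a 0 1| <= (1 + enorm y) / enorm (chord x y a) ^+ 2 &
      `|kernel_integrand x y a 0 2| <= enorm y / enorm (chord x y a) ^+ 2].
Proof.
have D0 : 0 <= enorm (chord x y a) by exact: enorm_ge0.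
have Y0 : 0 <= enorm y by exact: enorm_ge0.
rewrite kernel_integrand0E kernel_integrand1E kernel_integrand2E.
have [d0 d1 d2] := chord_coord x y a.
have := normr_coord_le (chord x y a) 0; rewrite d0.
have := normr_coord_le (chord x y a) 1; rewrite d1.
have := normr_coord_le (chord x y a) 2; rewrite d2 normrN.
have := chord_sqr x y a; have := enorm2_sqr (Defs.rot a y); rewrite enorm_rot.
have := normr_coord_le (Defs.rot a y) 0; have := normr_coord_le (Defs.rot a y) 1.
rewrite enorm_rot.
set D := enorm _ in D0 *; set Y := enorm y in Y0 *.
set z0 := _ 0 0; set z1 := Defs.rot a y 0 1.
move: (x 0 0 - z0) (x 0 1 - z1) => u v z1Y z0Y Y2 D2 aD vD uD.
have key B t : `|t| <= B * D -> `|(D ^+ 3)^-1 * t| <= B / D ^+ 2.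
  move=> tB; rewrite normrM normfV normrX (ger0_norm D0).
  (* When D = 0 both sides vanish, because the inverse of 0 is 0. *)
  have [->|Dn0] := eqVneq D 0; first by rewrite !expr0n/= invr0 !mul0r mulr0.
  rewrite (_ : B / D ^+ 2 = (D ^+ 3)^-1 * (B * D)); last by field.
  by rewrite ler_wpM2l// invr_ge0 exprn_ge0.
have prod s t : `|s| <= D -> `|t| <= Y -> `|s * t| <= Y * D.
  by move=> ? ?; rewrite normrM mulrC ler_pM.
split; apply: key.
- by rewrite mulrDl mul1r (le_trans (ler_normB _ _))// lerD// prod.
- rewrite mulrDl mul1r (le_trans (ler_normB _ _))// addrC lerD// mulNr normrN.
  by rewrite prod.
- rewrite normrN; apply: normr_le_sqr; first by rewrite mulr_ge0.
  rewrite exprMn Y2 D2.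
  (* Cauchy-Schwarz in the plane, again through Lagrange's identity; the a^2 part of D^2 is
     discarded. *)
  have := sqr_ge0 (u * z1 - v * z0).
  have : 0 <= (z0 ^+ 2 + z1 ^+ 2) * a ^+ 2.
    by rewrite mulr_ge0 ?sqr_ge0 ?addr_ge0 ?sqr_ge0.
  lra.
Qed.

(** * Positivity of the distance and measurability of the integrand *)

(** A zero chord has last coordinate -a = 0; the rotation is then the identity and x = y. *)
Lemma chord_gt0 x y a : x != y -> 0 < enorm (chord x y a).
Proof.
move=> xy; rewrite lt_neqAle enorm_ge0 andbT eq_sym.
apply: contra xy => /eqP/enorm_eq0 c0.
have [] := chord_coord x y a; rewrite c0 !mxE/= => d0 d1 /esym/eqP.
rewrite oppr_eq0 => /eqP a0; move: d0 d1; rewrite a0 cos0 sin0 => d0 d1.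
apply/eqP/rowP => i.
have [->|->] : i = 0 \/ i = 1 by case: i => -[|[|//]] ?; [left|right]; exact/val_inj.
- lra.
- lra.
Qed.

Lemma continuous_enorm_chord x y : continuous (fun a => enorm (chord x y a)).
Proof.
move=> a.
under eq_fun do rewrite -[enorm _]ger0_norm ?enorm_ge0// -sqrtr_sqr chord_sqrE.
apply: continuous_comp; last exact: sqrt_continuous.
apply: continuousD; last exact: exprn_continuous.
apply: continuousB; first exact: cst_continuous.
apply: continuousM; first exact: cst_continuous.
apply: continuousD; apply: continuousM; try exact: cst_continuous.
- exact: continuous_cos.
- exact: continuous_sin.
Qed.

Lemma measurable_kernel_integrand x y i : x != y ->
  measurable_fun [set: R] (fun a => kernel_integrand x y a 0 i).
Proof.
move=> xy.
have mz0 : measurable_fun [set: R] (fun a => Defs.rot a y 0 0).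
  under eq_fun do rewrite mxE/=.
  apply: measurable_funD; apply: measurable_funM => //;
    apply: continuous_measurable_fun; [exact: continuous_cos|exact: continuous_sin].
have mz1 : measurable_fun [set: R] (fun a => Defs.rot a y 0 1).
  under eq_fun do rewrite mxE/=.
  apply: measurable_funD; apply: measurable_funM => //;
    apply: continuous_measurable_fun; [exact: continuous_sin|exact: continuous_cos].
have mc : measurable_fun [set: R] (fun a => (enorm (chord x y a) ^+ 3)^-1).
  apply: continuous_measurable_fun => a.
  apply: cvgV; first by rewrite gt_eqF// exprn_gt0// chord_gt0.
  apply: (@continuous_comp _ _ _ (fun a => enorm (chord x y a)) (fun r => r ^+ 3)).
    exact: continuous_enorm_chord.
  exact: exprn_continuous.
have [->|[->|->]] : i = 0 \/ i = 1 \/ i = 2.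
- by case: i => -[|[|[|//]]] ilt; [left|right; left|right; right]; exact/val_inj.
- under eq_fun do rewrite kernel_integrand0E.
  apply: measurable_funM => //; apply: measurable_funB; first by apply: measurable_funB.
  by apply: measurable_funM.
- under eq_fun do rewrite kernel_integrand1E.
  apply: measurable_funM => //; apply: measurable_funB; last by apply: measurable_funB.
  by apply: measurable_funM => //; apply: measurable_funN.
- under eq_fun do rewrite kernel_integrand2E.
  apply: measurable_funM => //; apply: measurable_funN.
  by apply: measurable_funD; apply: measurable_funM => //; apply: measurable_funB.
Qed.

(** * Bounds for K by integrable weights *)

(** The weight [w] first makes the integrand integrable, which allows the absolute value to pass
    under the integral, and then bounds it. The prefactor 1/(4 pi) is at most 1 and is dropped. *)
Lemma kernelK_le x y i (B : R) (w : R -> R) : x != y -> 0 <= B ->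
  mu.-integrable [set: R] (EFin \o w) ->
  (forall a, (enorm (chord x y a) ^+ 2)^-1 <= w a) ->
  (forall a, `|kernel_integrand x y a 0 i| <= B / enorm (chord x y a) ^+ 2) ->
  `|kernelK x y 0 i| <= B * \int[mu]_a w a.
Proof.
move=> xy B0 iw Nw kB.
have kw a : `|kernel_integrand x y a 0 i| <= B * w a.
  by rewrite (le_trans (kB a))// ler_wpM2l.
have iBw : mu.-integrable [set: R] (EFin \o (fun a => B * w a)).
  by apply: eq_integrable (integrableZl _ B iw).
have ik : mu.-integrable [set: R] (EFin \o (fun a => kernel_integrand x y a 0 i)).
  apply: le_integrable iBw => //.
    by apply/measurable_EFinP; exact: measurable_kernel_integrand.
  by move=> a _ /=; rewrite lee_fin (le_trans (kw a))// ler_norm.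
have pi4 : 1 <= 4 * (pi : R) by have := pi_ge2 R; lra.
rewrite /kernelK !mxE normrM normrN normfV (@ger0_norm _ (4 * pi)); last by lra.
apply: (@le_trans _ _ `|\int[mu]_a kernel_integrand x y a 0 i|).
  by rewrite ler_piMl// invf_le1//; lra.
rewrite (le_trans (le_normr_Rintegral _ ik))// -RintegralZl//.
apply: le_Rintegral => //; exact: integrable_norm.
Qed.

Lemma kernelK_bound x y (w : R -> R) : x != y ->
  mu.-integrable [set: R] (EFin \o w) ->
  (forall a, (enorm (chord x y a) ^+ 2)^-1 <= w a) ->
  [/\ `|kernelK x y 0 0| <= (1 + enorm y) * \int[mu]_a w a,
      `|kernelK x y 0 1| <= (1 + enorm y) * \int[mu]_a w a &
      `|kernelK x y 0 2| <= enorm y * \int[mu]_a w a].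
Proof.
move=> xy iw Nw; have Y0 : 0 <= enorm y by exact: enorm_ge0.
by split; apply: kernelK_le => //; rewrite ?addr_ge0// => a;
  have [] := kernel_integrand_le x y a.
Qed.

Lemma integrableZl_lorentzian (c k b : R) : 0 < k ->
  mu.-integrable [set: R] (EFin \o (fun a => c * lorentzian k b a)).
Proof.
move=> k0.
by apply: eq_integrable (integrableZl measurableT c (integrable_lorentzian b k0)).
Qed.

Lemma RintegralZl_lorentzian (c k b : R) : 0 < k ->
  \int[mu]_a (c * lorentzian k b a) = c * pi.
Proof.
move=> k0.
by rewrite RintegralZl ?Rintegral_lorentzian//; exact: integrable_lorentzian.
Qed.

(** The weight adds a peaked Lorentzian, used for |a| <= 1/4, to a fixed one used elsewhere; both
    are nonnegative on the whole line, so no integral has to be split. The total 17 pi + 3 pi/|x -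
    y| is at most 68 M because pi < 4. *)
Lemma kernelK_near x y (M := 1 + (enorm (x - y))^-1) : x != y ->
  [/\ `|kernelK x y 0 0| <= (1 + enorm y) * (68 * M),
      `|kernelK x y 0 1| <= (1 + enorm y) * (68 * M) &
      `|kernelK x y 0 2| <= enorm y * (68 * M)].
Proof.
move=> xy; have r0 := enormB_gt0 xy.
have [p [b [p1 hp]]] := chord_near x y.
have p0 : 0 < p by rewrite (lt_le_trans ltr01).
have s0 : 0 < enorm (x - y) / 3 by rewrite divr_gt0.
set s := _ / 3 in hp s0.
have ps0 : 0 < p / s by rewrite divr_gt0.
have i1 := integrableZl_lorentzian 17 0 (@ltr01 R).
have i2 := integrableZl_lorentzian s^-1 b ps0.
pose w a := 17 * lorentzian 1 0 a + s^-1 * lorentzian (p / s) b a.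
have iw : mu.-integrable [set: R] (EFin \o w).
  by apply: eq_integrable (integrableD _ i1 i2).
have wE : \int[mu]_a w a = 17 * pi + s^-1 * pi.
  by rewrite RintegralD// !RintegralZl_lorentzian.
have Nw a : (enorm (chord x y a) ^+ 2)^-1 <= w a.
  have c1 := lorentzian_ge0 0 a (@ltr01 R); have c2 := lorentzian_ge0 b a ps0.
  have si0 : 0 <= s^-1 by rewrite invr_ge0 ltW.
  have [a4|a4] := leP `|a| (1 / 4).
    apply: le_trans (inv_le_lorentzian p0 s0 (hp a a4)) _.
    by rewrite lerDr mulr_ge0.
  (* Since 1/a^2 < 16 here, 1 + a^2 <= 17 a^2, that is, 1/a^2 <= 17/(1 + a^2). *)
  apply: (@le_trans _ _ (17 * lorentzian 1 0 a)); last by rewrite lerDl mulr_ge0.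
  have a2 : (1 / 4) ^+ 2 < a ^+ 2.
    by rewrite -(real_normK (num_real a)) ltr_pXn2r// nnegrE; lra.
  have aN := chord_sqr_ge x y a; have := sqr_ge0 (enorm x - enorm y) => xy0.
  rewrite /lorentzian /oneDsqr subr0 !mul1r ler_pdivlMr; last by nra.
  rewrite mulrC ler_pdivrMr; nra.
have wM : \int[mu]_a w a <= 68 * M.
  have := pihalf_lt2 R; have := pi_gt0 R.
  have : 0 < (enorm (x - y))^-1 by rewrite invr_gt0.
  rewrite wE /M /s invf_div; nra.
have Y0 : 0 <= enorm y by exact: enorm_ge0.
have [k0 k1 k2] := kernelK_bound xy iw Nw.
split; [apply: le_trans k0 _|apply: le_trans k1 _|apply: le_trans k2 _];
  by rewrite ler_wpM2l// addr_ge0.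
Qed.

(** Here N(a) >= d^2 + a^2 for all a, so one Lorentzian centred at 0, with integral pi/d < 4/d, is
    enough. *)
Lemma kernelK_far x y (d : R) : x != y -> 0 < d ->
  d <= `|enorm x - enorm y| ->
  [/\ `|kernelK x y 0 0| <= (1 + enorm y) * (4 / d),
      `|kernelK x y 0 1| <= (1 + enorm y) * (4 / d) &
      `|kernelK x y 0 2| <= enorm y * (4 / d)].
Proof.
move=> xy d0 dxy.
have id0 : 0 < 1 / d by rewrite divr_gt0.
have iw := integrableZl_lorentzian d^-1 0 id0.
have Nw a : (enorm (chord x y a) ^+ 2)^-1 <= d^-1 * lorentzian (1 / d) 0 a.
  apply: inv_le_lorentzian => //; rewrite !mul1r subr0.
  apply: le_trans (chord_sqr_ge x y a); rewrite addrC lerD2r.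
  rewrite -(real_normK (num_real (enorm x - enorm y))).
  by rewrite ler_pXn2r// nnegrE ltW.
have wM : \int[mu]_a (d^-1 * lorentzian (1 / d) 0 a) <= 4 / d.
  rewrite RintegralZl_lorentzian// mulrC ler_pM2r ?invr_gt0//.
  have := pihalf_lt2 R; lra.
have Y0 : 0 <= enorm y by exact: enorm_ge0.
have [k0 k1 k2] := kernelK_bound xy iw Nw.
split; [apply: le_trans k0 _|apply: le_trans k1 _|apply: le_trans k2 _];
  by rewrite ler_wpM2l// addr_ge0.
Qed.

(** * From components of K to the norms of H1 and H2 *)

Lemma enorm_vec2_sqr (a b : R) : enorm (vec2 a b) ^+ 2 = a ^+ 2 + b ^+ 2.
Proof. by rewrite enorm2_sqr !mxE. Qed.

Lemma enormZ n (c : R) (v : 'rV[R]_n) : enorm (c *: v) = `|c| * enorm v.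
Proof.
apply/eqP; rewrite -(@eqrXn2 _ 2) ?mulr_ge0 ?enorm_ge0//; apply/eqP.
rewrite exprMn real_normK ?num_real// !enorm_sqr mulr_sumr.
by apply: eq_bigr => i _; rewrite mxE exprMn.
Qed.

Lemma enorm_H1_le x y : enorm (H1 x y) <= `|kernelK x y 0 0| + `|kernelK x y 0 1|.
Proof.
apply: le_trans (ler_norm _) _; apply: normr_le_sqr; first exact: addr_ge0.
rewrite enorm_vec2_sqr -(real_normK (num_real (kernelK x y 0 0))).
rewrite -(real_normK (num_real (kernelK x y 0 1))).
have := normr_ge0 (kernelK x y 0 0); have := normr_ge0 (kernelK x y 0 1); nra.
Qed.

Lemma enorm_H2 x y : enorm (H2 x y) = `|kernelK x y 0 2| * enorm x.
Proof.
rewrite enormZ; congr (_ * _).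
apply/eqP; rewrite -(@eqrXn2 _ 2) ?enorm_ge0//; apply/eqP.
by rewrite enorm_vec2_sqr enorm2_sqr sqrrN addrC.
Qed.

End Kernel.

(** * Choosing between the near and far bounds *)

Theorem proposition3p2 (R : realType) :
  exists C : R, 0 < C /\
    forall x y : 'rV[R]_2, x != y ->
      enorm (H1 x y) <=
        C * Num.min (jbracket y * (1 + (enorm (x - y))^-1))
                    (jbracket x * (1 + (enorm (x - y))^-1))
      /\
      enorm (H2 x y) <=
        C * Num.min (jbracket x ^+ 2 * (1 + (enorm (x - y))^-1))
           (Num.min (jbracket y ^+ 2 * (1 + (enorm (x - y))^-1))
                    (jbracket x * jbracket y * (1 + (enorm (x - y))^-1))).
Proof.
(* The largest constant arising below is 544 = 2 * 68 * 4, in the bound of H1 by the bracket of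
   x. *)
exists 1000; split=> [|x y xy]; first by rewrite ltr0n.
have r0 : 0 < (enorm (x - y))^-1 by rewrite invr_gt0 enormB_gt0.
have [n0 n1 n2] := kernelK_near xy.
have [bx1 bx] := jbracket_ge x; have [by1 byy] := jbracket_ge y.
have X0 : 0 <= enorm x by exact: enorm_ge0.
have Y0 : 0 <= enorm y by exact: enorm_ge0.
move: n0 n1 n2; set M := 1 + _^-1 => n0 n1 n2.
have M1 : 1 <= M by rewrite /M lerDl ltW.
(* Here |y| - |x| >= |y|/2, so the decay 8/|y| cancels the growth of the numerators in y. The
   summand 1 forces |y| > 1, hence (1 + |y|) * 8/|y| <= 16 for each of the two components. *)
have far_y : 2 * enorm x + 1 < enorm y ->
    `|kernelK x y 0 0| + `|kernelK x y 0 1| <= 32 /\ `|kernelK x y 0 2| <= 8.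
  move=> h; have y0 : enorm y != 0 by rewrite gt_eqF//; lra.
  have [|| f0 f1 f2] := @kernelK_far R x y (enorm y / 2) xy; first by lra.
    by rewrite ler_normr; apply/orP; right; lra.
  have e1 : enorm y * (4 / (enorm y / 2)) = 8 by field.
  have e2 : 4 / (enorm y / 2) <= 8 by rewrite ler_pdivrMr; lra.
  by rewrite e1 in f2; split=> //; move: f0 f1; rewrite mulrDl e1; lra.
(* The decay 8/|x| cancels the factor |x| in the norm of H2. *)
have far_x : 2 * enorm y + 1 < enorm x ->
    `|kernelK x y 0 2| * enorm x <= 8 * enorm y.
  move=> h; have x0 : enorm x != 0 by rewrite gt_eqF//; lra.
  have [|| _ _ f2] := @kernelK_far R x y (enorm x / 2) xy; first by lra.
    by rewrite ler_normr; apply/orP; left; lra.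
  apply: le_trans (ler_wpM2r X0 f2) _.
  by rewrite le_eqVlt; apply/orP; left; apply/eqP; field.
have h1 := enorm_H1_le x y.
rewrite !(minr_pMr _ _ (ler0n R 1000)) !le_min enorm_H2.
move: (enorm (H1 x y)) (`|kernelK x y 0 0|) (`|kernelK x y 0 1|)
  (`|kernelK x y 0 2|) h1 n0 n1 n2 far_x far_y
  => E k0 k1 k2 h1 n0 n1 n2 far_x far_y.
have xM : jbracket x <= jbracket x * M by rewrite ler_peMr//; lra.
have yM : jbracket y <= jbracket y * M by rewrite ler_peMr//; lra.
have k2x := ler_wpM2r X0 n2.
split; apply/andP; split.
- have : (1 + enorm y) * M <= (2 * jbracket y) * M by rewrite ler_wpM2r; lra.
  lra.
(* In the comparable case 1 + |y| <= 2 + 2|x|, at most four brackets of x; otherwise the far bound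
   is a constant. *)
- have [yx|yx] := leP (enorm y) (2 * enorm x + 1); last by have [] := far_y yx; lra.
  have : (1 + enorm y) * M <= (4 * jbracket x) * M by rewrite ler_wpM2r; lra.
  lra.
- have xx : jbracket x <= jbracket x ^+ 2 by rewrite expr2 ler_peMl; lra.
  have xxM : jbracket x ^+ 2 <= jbracket x ^+ 2 * M by rewrite ler_peMr; lra.
  have [yx|yx] := leP (enorm y) (2 * enorm x + 1).
    have : enorm y * enorm x <= (3 * jbracket x) * jbracket x by rewrite ler_pM; lra.
    move=> /(ler_wpM2r (ltW (lt_le_trans ltr01 M1))); lra.
  have [_ k28] := far_y yx.
  have := ler_wpM2r X0 k28; lra.
(* The mixed bound comes first and follows from the near estimate alone; the one in y needs the
   dichotomy on |x|. *)
- apply/andP; split; last first.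
    have : enorm y * enorm x <= jbracket y * jbracket x by rewrite ler_pM.
    move=> /(ler_wpM2r (ltW (lt_le_trans ltr01 M1))).
    have : 0 <= jbracket x * jbracket y * M by rewrite !mulr_ge0; lra.
    lra.
  have yy : jbracket y <= jbracket y ^+ 2 by rewrite expr2 ler_peMl; lra.
  have yyM : jbracket y ^+ 2 <= jbracket y ^+ 2 * M by rewrite ler_peMr; lra.
  have [yx|/far_x] := leP (enorm x) (2 * enorm y + 1); last by lra.
  have : enorm y * enorm x <= jbracket y * (3 * jbracket y) by rewrite ler_pM; lra.
  move=> /(ler_wpM2r (ltW (lt_le_trans ltr01 M1))); lra.
Qed.
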